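(* For $a\in(0,1)\cup(1,\infty)$ let $\mathcal S(a)$ denote the c-entropy of the L-systems representing $aM_{(\dot A,A)}(z)$, that is, $\mathcal S(a)=\ln(1+a)-\ln(1-a)$ for $0<a<1$ and $\mathcal S(a)=\ln(a+1)-\ln(a-1)$ for $a>1$. Let $$\mathfrak S(a)=\ln(a+1)-\ln(a-1),\qquad a\in\mathbb C_+,$$ where $\ln$ is the principal branch of the logarithm, real on the positive real axis. Then $\mathcal S(a)=\ln\left|\frac{a+1}{a-1}\right|$ and $$\mathcal S(a)=\mathrm{Re}\,\mathfrak S(a+i0),\qquad a\in(0,1)\cup(1,\infty),$$ and the one-form $d\mathfrak S(a)$ is an Abelian differential of the third kind on the Riemann surface $\mathfrak R=\mathbb C\cup\{\infty\}$ with simple poles at $a=\pm1$ and $$\mathrm{Res}(d\mathfrak S)|_{a=\pm1}=\mp1.$$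
   Context: $\mathbb C_+$ is the open upper half-plane and $\mathfrak S(a+i0)=\lim_{\varepsilon\downarrow0}\mathfrak S(a+i\varepsilon)$. An Abelian differential of the third kind on a compact Riemann surface is a meromorphic one-form all of whose poles are simple. The one-form $d\mathfrak S=\mathfrak S'(a)\,da$ is understood as the meromorphic one-form on $\mathbb C\cup\{\infty\}$ obtained by analytic continuation from $\mathbb C_+$. Origin of $\mathcal S(a)$: the c-entropy of an L-system $\Theta$ with transfer function $W_\Theta$ is $-\ln|W_\Theta(-i)|$; the explicit values of $\mathcal S(a)$ given in the claim are those of the L-systems whose impedance function is $aM_{(\dot A,A)}(z)$ with $M_{(\dot A,A)}$ the Weyl-Titchmarsh function of a symmetric operator $\dot A$ with deficiency indices $(1,1)$ and its self-adjoint extension $A$; only these explicit formulas are needed. *)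

(* Defs.v *)
From Stdlib Require Import Reals Lra.
From Coquelicot Require Import Coquelicot.
Open Scope R_scope.

(** Explicit values of the c-entropy; only meaningful on (0,1) U (1,+oo). *)
Definition c_entropy (a : R) : R :=
  if Rlt_dec a 1 then ln (1 + a) - ln (1 - a) else ln (a + 1) - ln (a - 1).

(** Principal argument, with values in (-PI, PI]. *)
Definition Carg (z : C) : R :=
  if Rle_dec 0 (Im z) then acos (Re z / Cmod z) else - acos (Re z / Cmod z).

(** At [z = 0] the value is junk, since [ln 0 = 0]. *)
Definition Clog (z : C) : C := (ln (Cmod z), Carg z).

Definition Cexp (z : C) : C := (exp (Re z) * cos (Im z), exp (Re z) * sin (Im z)).

Lemma Carg_bound (z : C) : z <> 0 -> - PI < Carg z <= PI.
Proof.
  intros Hz; unfold Carg.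
  pose proof (acos_bound (Re z / Cmod z)) as Hb.
  pose proof PI_RGT_0.
  destruct (Rle_dec 0 (Im z)) as [H0|H0]; [lra|].
  assert (Hm : 0 < Cmod z) by now apply Cmod_gt_0.
  assert (Hlt : -1 < Re z / Cmod z < 1).
  { apply and_comm, Rabs_def2.
    rewrite Rabs_div by lra.
    rewrite (Rabs_pos_eq (Cmod z)) by lra.
    apply Rmult_lt_reg_r with (Cmod z); [exact Hm|].
    replace (Rabs (Re z) / Cmod z * Cmod z) with (Rabs (Re z)) by (field; lra).
    rewrite Rmult_1_l.
    apply Rsqr_incrst_0; [|apply Rabs_pos|lra].
    rewrite <- Rsqr_abs, 2!Rsqr_pow2, Cmod2_alt. nra. }
  pose proof (acos_bound_lt _ Hlt). lra.
Qed.

Lemma Cexp_Clog (z : C) : z <> 0 -> Cexp (Clog z) = z.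
Proof.
  intros Hz.
  assert (Hm : 0 < Cmod z) by now apply Cmod_gt_0.
  pose proof (Cmod2_alt z) as H2.
  pose proof (re_le_Cmod z) as Hre.
  assert (Hin : -1 <= Re z / Cmod z <= 1).
  { apply Rabs_le_between in Hre.
    split; apply Rmult_le_reg_r with (Cmod z); try exact Hm;
    unfold Rdiv; rewrite Rmult_assoc, Rinv_l by lra; lra. }
  assert (Hsin : Cmod z * sqrt (1 - (Re z / Cmod z)²) = Rabs (Im z)).
  { rewrite <- (sqrt_Rsqr (Cmod z)) at 1 by lra.
    rewrite <- sqrt_mult_alt by apply Rle_0_sqr.
    rewrite <- sqrt_Rsqr_abs. f_equal.
    unfold Rsqr. field_simplify; [|lra]. rewrite H2; ring. }
  unfold Cexp, Clog; simpl.
  rewrite exp_ln by exact Hm.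
  rewrite (surjective_pairing z) at 5.
  change (fst z) with (Re z); change (snd z) with (Im z).
  unfold Carg; destruct (Rle_dec 0 (Im z)) as [H0|H0]; f_equal.
  - rewrite cos_acos by exact Hin. field; lra.
  - rewrite sin_acos, Hsin, Rabs_pos_eq by assumption. reflexivity.
  - rewrite cos_neg, cos_acos by exact Hin. field; lra.
  - rewrite sin_neg, sin_acos by exact Hin.
    rewrite Ropp_mult_distr_r_reverse, Hsin, Rabs_left by lra. ring.
Qed.

Lemma Clog_real (x : R) : 0 < x -> Clog (RtoC x) = RtoC (ln x).
Proof.
  intros Hx; unfold Clog, Carg.
  rewrite Cmod_R, Rabs_pos_eq by lra.
  change (Re (RtoC x)) with x; change (Im (RtoC x)) with 0.
  destruct (Rle_dec 0 0); [|lra].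
  replace (x / x) with 1 by (field; lra).
  now rewrite acos_1.
Qed.

Definition frakS (a : C) : C := (Clog (a + 1) - Clog (a - 1))%C.

(** [g t = sum_n c n * t ^ (n - N)] for small [t <> 0]. *)
Definition laurent_expansion (g : C -> C) (N : nat) (c : nat -> C) : Prop :=
  exists r : R, 0 < r /\
    forall t : C, 0 < Cmod t < r -> is_pseries c t (t ^ N * g t)%C.

Definition holomorphic_at_0 (g : C -> C) : Prop :=
  exists (c : nat -> C) (r : R), 0 < r /\
    forall t : C, Cmod t < r -> is_pseries c t (g t).

Definition pole_at_0 (g : C -> C) (N : nat) : Prop :=
  (1 <= N)%nat /\ exists c : nat -> C, laurent_expansion g N c /\ c O <> 0.

(** The coefficient of [t ^ -1] is [c (N - 1)], or 0 when [N = 0]. *)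
Definition residue_at_0 (g : C -> C) (res : C) : Prop :=
  exists (N : nat) (c : nat -> C), laurent_expansion g N c /\
    res = match N with O => RtoC 0 | S n => c n end.

Inductive sphere : Type :=
  | Fin (z : C)
  | Infty.

(** A one-form is [coef a da] in the chart [a] and [coef_infty w dw] in the
    chart [w = 1 / a] around infinity; the compatibility condition is
    [da = - dw / w ^ 2].  The coefficients are total functions, whose values at
    the poles of the form carry no information. *)
Record one_form : Type := {
  coef : C -> C;
  coef_infty : C -> C;
  coef_compat : forall w : C, w <> 0 ->
    coef_infty w = (- (coef (/ w) / w ^ 2))%C
}.

(** The coefficient of [omega] in a local coordinate [t] centred at [p]. *)
Definition local_coef (omega : one_form) (p : sphere) (t : C) : C :=
  match p with
  | Fin z => coef omega (z + t)
  | Infty => coef_infty omega t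
  end.

Definition holomorphic_at (omega : one_form) (p : sphere) : Prop :=
  holomorphic_at_0 (local_coef omega p).

Definition pole_of_order (omega : one_form) (p : sphere) (N : nat) : Prop :=
  pole_at_0 (local_coef omega p) N.

Definition simple_pole (omega : one_form) (p : sphere) : Prop :=
  pole_of_order omega p 1.

Definition is_residue (omega : one_form) (p : sphere) (res : C) : Prop :=
  residue_at_0 (local_coef omega p) res.

Definition meromorphic (omega : one_form) : Prop :=
  forall p : sphere,
    holomorphic_at omega p \/ exists N : nat, pole_of_order omega p N.

Definition third_kind (omega : one_form) : Prop :=
  meromorphic omega /\
  forall (p : sphere) (N : nat), pole_of_order omega p N -> N = 1%nat.

Definition continues_differential (S : C -> C) (omega : one_form) : Prop :=
  meromorphic omega /\
  forall a : C, 0 < Im a ->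
    is_derive (K := C_AbsRing) (V := C_NormedModule) S a (coef omega a).

(* Main.v *)
(** On the upper half-plane [Clog z = ln |z| + i (PI / 2 - atan (Re z / Im z))];
    this gives both the boundary values on the real axis and, by the
    Cauchy-Riemann equations, [frakS' a = 1 / (a + 1) - 1 / (a - 1)].
    A meromorphic form continuing [frakS' a da] must agree with this rational
    form near every point.  No re-expansion of power series is needed: the set of
    points around which two meromorphic functions agree is open, and it contains
    each of its accumulation points, because a convergent power series with zeros
    accumulating at its centre vanishes identically; so one may sweep down
    vertical lines from the upper half-plane.  Pole orders and residues are then
    read off by uniqueness of Laurent coefficients. *)
Require Import Defs.
From Stdlib Require Import Reals Lra Lia Classical.
From Coquelicot Require Import Coquelicot.
Open Scope R_scope.

(** * Complex power series: bounds near the centre and uniqueness of coefficients *)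

Notation Cseries := (@is_series C_AbsRing C_NormedModule).
Notation Cpseries := (@is_pseries C_AbsRing C_NormedModule).

Notation Csum := (@sum_n (NormedModule.AbelianMonoid _ C_NormedModule)).

Lemma pow_n_Cpow (x : C) (n : nat) : @pow_n C_AbsRing x n = (x ^ n)%C.
Proof. induction n as [|n IH]; [reflexivity|]. simpl. now rewrite IH. Qed.

Lemma Cseries_spec (a : nat -> C) (l : C) :
  Cseries a l <->
  forall eps : R, 0 < eps -> exists N : nat, forall n : nat, (N <= n)%nat ->
    Cmod (Csum a n - l)%C < eps.
Proof.
  split.
  - intros H eps He.
    exact (proj1 (filterlim_locally_ball_norm
      (F := eventually) (K := C_AbsRing) (U := C_NormedModule) (Csum a) l) H
      (mkposreal eps He)).
  - intros H. apply (proj2 (filterlim_locally_ball_norm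
      (F := eventually) (K := C_AbsRing) (U := C_NormedModule) (sum_n a) l)).
    intros eps. destruct (H eps (cond_pos eps)) as [N HN]. now exists N.
Qed.

Lemma Cpseries_Cseries (c : nat -> C) (t l : C) :
  Cpseries c t l <-> Cseries (fun k => t ^ k * c k)%C l.
Proof.
  assert (E : forall k, @scal C_AbsRing C_NormedModule (@pow_n C_AbsRing t k) (c k)
                        = (t ^ k * c k)%C) by (intros k; now rewrite pow_n_Cpow).
  split; intros H; (eapply (is_series_ext (K := C_AbsRing) (V := C_NormedModule)); [|exact H]);
    intros k; [|symmetry]; apply E.
Qed.

Lemma Cmod_minus_sym (x y : C) : Cmod (x - y)%C = Cmod (y - x)%C.
Proof. rewrite <- Cmod_opp. f_equal. ring. Qed.

(** Convergence at [t0] bounds the terms [c n * t0 ^ n]; for [Cmod t <= Cmod t0 / 2] the terms after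
    the constant one are then dominated by a geometric series of ratio 1/2 with a factor
    proportional to [Cmod t]. *)
Lemma Cpseries_lipschitz_0 (c : nat -> C) (t0 l0 : C) :
  t0 <> 0 -> Cpseries c t0 l0 ->
  exists M : R, 0 < M /\ forall t l : C,
    Cmod t <= Cmod t0 / 2 -> Cpseries c t l -> Cmod (l - c O)%C <= M * Cmod t.
Proof.
  intros Ht0 H0.
  assert (Hm : 0 < Cmod t0) by now apply Cmod_gt_0.
  assert (HB : exists B, 0 < B /\ forall n, Cmod (c n) * Cmod t0 ^ n <= B).
  { destruct (filterlim_bounded (K := C_AbsRing) (V := C_NormedModule) _ (ex_intro _ _ (proj1 (Cpseries_Cseries _ _ _) H0))) as [M HM].
    assert (HM' : forall n, Cmod (Csum (fun k : nat => (t0 ^ k * c k)%C) n) <= M).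
    { exact HM. }
    pose proof (Cmod_ge_0 (Csum (fun k : nat => (t0 ^ k * c k)%C) 0)).
    (* Each term is a difference of two partial sums, hence at most [2 * M]; adding 1 makes the
       bound positive. *)
    exists (2 * M + 1). split; [specialize (HM' O); lra|].
    intros n. rewrite <- Cmod_pow, <- Cmod_mult.
    destruct n as [|n].
    - pose proof (HM' O) as Q. rewrite sum_O in Q. rewrite Cmult_comm. specialize (HM' O); lra.
    - replace (c (S n) * t0 ^ S n)%C with
        (Csum (fun k : nat => (t0 ^ k * c k)%C) (S n) + - Csum (fun k : nat => (t0 ^ k * c k)%C) n)%C.
      + pose proof (Cmod_triangle (Csum (fun k : nat => (t0 ^ k * c k)%C) (S n)) (- Csum (fun k : nat => (t0 ^ k * c k)%C) n)%C) as T.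
        rewrite Cmod_opp in T. pose proof (HM' n); pose proof (HM' (S n)); lra.
      + rewrite sum_Sn. change (@plus (NormedModule.AbelianMonoid _ C_NormedModule)) with Cplus. ring. }
  destruct HB as [B [HB0 HB]].
  exists (2 * B / Cmod t0). split; [apply Rdiv_lt_0_compat; lra|].
  intros t l Ht Hl.
  set (q := Cmod t / Cmod t0).
  assert (Hq : 0 <= q <= / 2).
  { unfold q; split; [apply Rdiv_le_0_compat; [apply Cmod_ge_0|lra]|].
    apply Rle_div_l; lra. }
  (* The factor [1 - (/2) ^ n] makes the induction close: it leaves room for exactly
     [B * q * (/2) ^ n], the bound on the next term. *)
  assert (Hs : forall n, Cmod (Csum (fun k : nat => (t ^ k * c k)%C) n - c O)%C
                 <= 2 * B * q * (1 - (/2) ^ n)).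
  { induction n as [|n IH].
    - rewrite sum_O. simpl. replace (1 * c O - c O)%C with (RtoC 0) by ring.
      rewrite Cmod_0. lra.
    - rewrite sum_Sn. change (@plus (NormedModule.AbelianMonoid _ C_NormedModule)) with Cplus.
      match goal with |- Cmod (?s + ?u - ?v)%C <= _ =>
        replace (s + u - v)%C with ((s - v) + u)%C by ring end.
      eapply Rle_trans; [apply Cmod_triangle|].
      assert (Cmod (t ^ S n * c (S n)) <= B * q * (/2)^n).
      { rewrite Cmod_mult, Cmod_pow.
        replace (Cmod t) with (q * Cmod t0) by (unfold q; field; lra).
        rewrite Rpow_mult_distr.
        replace (q ^ S n * Cmod t0 ^ S n * Cmod (c (S n)))
          with ((Cmod (c (S n)) * Cmod t0 ^ S n) * (q * q ^ n)) by (simpl; ring).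
        rewrite (Rmult_assoc B).
        apply Rmult_le_compat; [|apply Rmult_le_pos; [lra|now apply pow_le]|apply HB|].
        - apply Rmult_le_pos; [apply Cmod_ge_0|apply pow_le; lra].
        - apply Rmult_le_compat_l; [lra|]. now apply pow_incr. }
      rewrite <- (tech_pow_Rmult (/ 2)). lra. }
  replace (2 * B / Cmod t0 * Cmod t) with (2 * B * q) by (unfold q; field; lra).
  apply le_epsilon. intros eps He.
  destruct (proj1 (Cseries_spec _ _) (proj1 (Cpseries_Cseries _ _ _) Hl) eps He) as [N HN].
  specialize (HN N (le_n N)).
  specialize (Hs N).
  assert (0 <= 2 * B * q * (/2)^N).
  { apply Rmult_le_pos; [apply Rmult_le_pos; lra|apply pow_le; lra]. }
  rewrite Cmod_minus_sym in HN.
  match goal with HN : Cmod (_ - ?s)%C < _ |- _ =>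
    replace (l - c O)%C with ((l - s) + (s - c O))%C by ring;
    pose proof (Cmod_triangle (l - s) (s - c O)) end.
  lra.
Qed.

(** At a zero [t] of [phi] the Lipschitz bound reads [Cmod (c O) <= M * Cmod t], and [t] may be
    taken arbitrarily small. Only the punctured disc enters, as Laurent expansions require. *)
Lemma Cpseries_coef_0_eq_0 (c : nat -> C) (phi : C -> C) (r : R) :
  0 < r -> (forall t, 0 < Cmod t < r -> Cpseries c t (phi t)) ->
  (forall eps, 0 < eps -> exists t, 0 < Cmod t < eps /\ phi t = 0) ->
  c O = 0.
Proof.
  intros Hr Hc Hz.
  assert (E : Cmod (RtoC (r / 2)) = r / 2) by (rewrite Cmod_R; apply Rabs_pos_eq; lra).
  destruct (Cpseries_lipschitz_0 c (RtoC (r / 2)) (phi (RtoC (r / 2)))) as [M [HM HL]].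
  { apply Cmod_gt_0. lra. }
  { apply Hc. lra. }
  apply Cmod_eq_0.
  apply Rle_antisym; [|apply Cmod_ge_0]. 
  apply le_epsilon. intros eps He.
  (* [r / 4] is half the modulus of the sample point [r / 2]; [eps / M] turns the Lipschitz bound
     into [eps]. *)
  destruct (Hz (Rmin (r / 4) (eps / M))) as [t [[Ht1 Ht2] Ht3]].
  { apply Rmin_glb_lt; [lra|]. now apply Rdiv_lt_0_compat. }
  pose proof (Rmin_l (r / 4) (eps / M)). pose proof (Rmin_r (r / 4) (eps / M)).
  specialize (HL t (phi t)).
  rewrite Ht3 in HL. 
  replace (0 - c O)%C with (- c O)%C in HL by ring. rewrite Cmod_opp in HL.
  rewrite Rplus_0_l. eapply Rle_trans; [apply HL|].
  - rewrite E. lra.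
  - rewrite <- Ht3. apply Hc. lra.
  - apply Rle_trans with (M * (eps / M)); [apply Rmult_le_compat_l; lra|].
    apply Req_le. field. lra.
Qed.

(** Once the constant coefficient vanishes, dividing by [t] shifts the series down by one and keeps
    the nonzero zeros, so induction on the index applies. *)
Lemma Cpseries_unique_0 (c : nat -> C) (phi : C -> C) (r : R) :
  0 < r -> (forall t, 0 < Cmod t < r -> Cpseries c t (phi t)) ->
  (forall eps, 0 < eps -> exists t, 0 < Cmod t < eps /\ phi t = 0) ->
  forall n, c n = 0.
Proof.
  intros Hr Hc Hz n. revert c phi Hc Hz.
  induction n as [|n IH]; intros c phi Hc Hz;
    pose proof (Cpseries_coef_0_eq_0 c phi r Hr Hc Hz) as H0; [exact H0|].
  apply (IH (PS_decr_1 c) (fun t => / t * phi t)%C).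
  - intros t Ht.
    assert (Hnz : t <> 0) by (apply Cmod_gt_0; lra).
    pose proof (is_pseries_decr_1 (K := C_AbsRing) (V := C_NormedModule) c t (/ t)%C (phi t)
      (Cinv_l t Hnz) (Hc t Ht)) as H.
    rewrite H0 in H.
    replace (/ t * phi t)%C with (@scal C_AbsRing C_NormedModule (/ t)%C
      (@plus C_NormedModule (phi t) (@opp C_NormedModule (RtoC 0)))); [exact H|].
    change (/ t * (phi t + - 0) = / t * phi t)%C. ring.
  - intros eps He. destruct (Hz eps He) as [t [Ht Ht0]].
    exists t. split; [exact Ht|]. rewrite Ht0. ring.
Qed.

(** * Laurent expansions: uniqueness, comparison of orders, differences *)

Lemma laurent_expansion_ext (f g : C -> C) (N : nat) (c : nat -> C) (r : R) :
  0 < r -> (forall t, 0 < Cmod t < r -> f t = g t) ->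
  laurent_expansion f N c -> laurent_expansion g N c.
Proof.
  intros Hr Hfg [s [Hs Hc]].
  exists (Rmin r s). split; [now apply Rmin_glb_lt|].
  intros t [Ht1 Ht2].
  pose proof (Rmin_l r s); pose proof (Rmin_r r s).
  rewrite <- Hfg by lra. apply Hc. lra.
Qed.

(** Padding with leading zero coefficients brings two expansions to a common order. *)
Lemma laurent_expansion_shift (f : C -> C) (N M : nat) (c : nat -> C) :
  laurent_expansion f N c ->
  laurent_expansion f (M + N) (@PS_incr_n C_AbsRing C_NormedModule c M).
Proof.
  intros [r [Hr Hc]]. exists r. split; [exact Hr|].
  intros t Ht.
  pose proof (is_pseries_incr_n (K := C_AbsRing) (V := C_NormedModule) c M t _ (Hc t Ht)) as H.
  rewrite pow_n_Cpow in H.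
  replace (t ^ (M + N) * f t)%C with (t ^ M * (t ^ N * f t))%C
    by (rewrite Cpow_add_r; ring).
  exact H.
Qed.

(** The series of [t ^ N * (f t - g t)] has zeros accumulating at 0, so all its coefficients vanish.
    With [f = g] this is uniqueness of coefficients; in general it is the local form of the identity
    theorem. *)
Lemma laurent_identity (f g : C -> C) (N : nat) (c d : nat -> C) :
  laurent_expansion f N c -> laurent_expansion g N d ->
  (forall eps, 0 < eps -> exists t, 0 < Cmod t < eps /\ f t = g t) ->
  (forall n, c n = d n) /\
  exists r, 0 < r /\ forall t, 0 < Cmod t < r -> f t = g t.
Proof.
  intros [r [Hr Hc]] [s [Hs Hd]] Hfg.
  set (rho := Rmin r s).
  assert (Hrho : 0 < rho) by now apply Rmin_glb_lt.
  pose proof (Rmin_l r s : rho <= r); pose proof (Rmin_r r s : rho <= s).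
  assert (Hm : forall t, 0 < Cmod t < rho ->
    Cpseries (@PS_minus C_AbsRing C_NormedModule c d) t (t ^ N * (f t - g t))%C).
  { intros t Ht.
    replace (t ^ N * (f t - g t))%C with (t ^ N * f t + - (t ^ N * g t))%C by ring.
    apply (is_pseries_minus (K := C_AbsRing) (V := C_NormedModule)); [apply Hc|apply Hd]; lra. }
  assert (Hz : forall n, @PS_minus C_AbsRing C_NormedModule c d n = RtoC 0).
  { apply (Cpseries_unique_0 _ (fun t => t ^ N * (f t - g t))%C rho); try assumption.
    intros eps He. destruct (Hfg eps He) as [t [Ht E]].
    exists t. split; [exact Ht|]. rewrite E. ring. }
  assert (Hcd : forall n, c n = d n).
  { intros n. specialize (Hz n).
    change (c n + - d n = 0)%C in Hz.
    replace (c n) with (c n + - d n + d n)%C by ring. rewrite Hz. ring. }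
  split; [exact Hcd|].
  exists rho. split; [exact Hrho|].
  intros t Ht.
  assert (Hcf : Cpseries c t (t ^ N * f t)%C) by (apply Hc; lra).
  assert (Hcg : Cpseries c t (t ^ N * g t)%C).
  { apply (is_series_ext (K := C_AbsRing) (V := C_NormedModule)
      (fun k => scal (pow_n t k) (d k))).
    - intros n. now rewrite Hcd.
    - apply Hd; lra. }
  assert (E : (t ^ N * f t = t ^ N * g t)%C)
    by exact (filterlim_locally_unique (K := C_AbsRing) (V := C_NormedModule) _ _ _ Hcf Hcg).
  assert (Hnz : (t ^ N <> 0)%C) by (apply Cpow_nz, Cmod_gt_0; lra).
  replace (f t) with (/ t ^ N * (t ^ N * f t))%C by (field; exact Hnz).
  rewrite E. field. exact Hnz.
Qed.

Lemma holomorphic_laurent_expansion (g : C -> C) :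
  holomorphic_at_0 g -> exists c, laurent_expansion g 0 c.
Proof.
  intros [c [r [Hr H]]]. exists c, r. split; [exact Hr|].
  intros t Ht. simpl. rewrite Cmult_1_l. apply H. lra.
Qed.

Lemma meromorphic_laurent_expansion (omega : one_form) (p : sphere) :
  meromorphic omega -> exists N c, laurent_expansion (local_coef omega p) N c.
Proof.
  intros H. destruct (H p) as [Hh|[N [_ [c [Hc _]]]]].
  - exists O. now apply holomorphic_laurent_expansion.
  - now exists N, c.
Qed.

(** If [M < N], padding [d] up to order [N] would put a zero in front, and uniqueness would force
    [c O = 0]. *)
Lemma laurent_order_le (f : C -> C) (N M : nat) (c d : nat -> C) :
  laurent_expansion f N c -> c O <> 0 -> laurent_expansion f M d -> (N <= M)%nat.
Proof.
  intros Hc H0 Hd. destruct (Nat.le_gt_cases N M) as [|Hlt]; [assumption|exfalso].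
  apply (laurent_expansion_shift _ _ (N - M)) in Hd.
  replace (N - M + M)%nat with N in Hd by lia.
  destruct (laurent_identity f f N _ _ Hc Hd) as [E _].
  { intros eps He. exists (RtoC (eps / 2)). split; [|reflexivity].
    rewrite Cmod_R, Rabs_pos_eq; lra. }
  apply H0. rewrite E. destruct (N - M)%nat eqn:K; [lia|reflexivity].
Qed.

Lemma laurent_expansion_minus (f g : C -> C) (N : nat) (c d : nat -> C) :
  laurent_expansion f N c -> laurent_expansion g N d ->
  laurent_expansion (fun t => f t - g t)%C N (fun n => c n - d n)%C.
Proof.
  intros [r [Hr Hc]] [s [Hs Hd]].
  exists (Rmin r s). split; [now apply Rmin_glb_lt|].
  intros t [Ht1 Ht2].
  pose proof (Rmin_l r s); pose proof (Rmin_r r s).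
  replace (t ^ N * (f t - g t))%C with (t ^ N * f t + - (t ^ N * g t))%C by ring.
  apply (is_pseries_minus (K := C_AbsRing) (V := C_NormedModule)); [apply Hc|apply Hd]; lra.
Qed.

Lemma holomorphic_at_0_minus (f g : C -> C) :
  holomorphic_at_0 f -> holomorphic_at_0 g -> holomorphic_at_0 (fun t => f t - g t)%C.
Proof.
  intros [c [r [Hr Hc]]] [d [s [Hs Hd]]].
  exists (fun n => c n - d n)%C, (Rmin r s). split; [now apply Rmin_glb_lt|].
  intros t Ht.
  pose proof (Rmin_l r s); pose proof (Rmin_r r s).
  apply (is_pseries_minus (K := C_AbsRing) (V := C_NormedModule)); [apply Hc|apply Hd]; lra.
Qed.

Lemma holomorphic_at_0_ext (f g : C -> C) (r : R) :
  0 < r -> (forall t, Cmod t < r -> f t = g t) ->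
  holomorphic_at_0 f -> holomorphic_at_0 g.
Proof.
  intros Hr Hfg [c [s [Hs Hc]]].
  exists c, (Rmin r s). split; [now apply Rmin_glb_lt|].
  intros t Ht.
  pose proof (Rmin_l r s); pose proof (Rmin_r r s).
  rewrite <- Hfg by lra. apply Hc. lra.
Qed.

(** Agreement on a punctured disc says nothing about the values of total functions at the centre;
    holomorphy fixes them, since a power series at 0 sums to its constant coefficient. *)
Lemma holomorphic_at_0_eq (f g : C -> C) (r : R) :
  holomorphic_at_0 f -> holomorphic_at_0 g ->
  0 < r -> (forall t, 0 < Cmod t < r -> f t = g t) -> f 0 = g 0.
Proof.
  intros [c [r1 [Hr1 Hc]]] [d [r2 [Hr2 Hd]]] Hr Hfg.
  assert (Hl : forall h a s, 0 < s -> (forall t, Cmod t < s -> Cpseries a t (h t)) ->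
            laurent_expansion h 0 a).
  { intros h a s Hs Ha. exists s. split; [exact Hs|].
    intros t Ht. simpl. rewrite Cmult_1_l. apply Ha. lra. }
  assert (Hv : forall h a s, 0 < s -> (forall t, Cmod t < s -> Cpseries a t (h t)) ->
            h (RtoC 0) = a O).
  { intros h a s Hs Ha. assert (H0 : Cmod 0 < s) by now rewrite Cmod_0.
    exact (filterlim_locally_unique (K := C_AbsRing) (V := C_NormedModule) _ _ _
      (Ha _ H0) (is_pseries_0 (K := C_AbsRing) (V := C_NormedModule) a)). }
  rewrite (Hv f c r1 Hr1 Hc), (Hv g d r2 Hr2 Hd).
  refine (proj1 (laurent_identity f g 0 c d (Hl f c r1 Hr1 Hc) (Hl g d r2 Hr2 Hd) _) O).
  intros eps He. exists (RtoC (Rmin r eps / 2)).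
  pose proof (Rmin_l r eps); pose proof (Rmin_r r eps).
  assert (0 < Rmin r eps) by now apply Rmin_glb_lt.
  assert (Cmod (RtoC (Rmin r eps / 2)) = Rmin r eps / 2) by (rewrite Cmod_R, Rabs_pos_eq; lra).
  split; [lra|]. apply Hfg. lra.
Qed.

(** * Local expansions of the rational derivative *)

Lemma Cplus_neq_0 (z t : C) : Cmod t < Cmod z -> (z + t <> 0)%C.
Proof.
  intros Ht E. replace t with (- z)%C in Ht.
  - rewrite Cmod_opp in Ht. lra.
  - replace t with (z + t - z)%C by ring. rewrite E. ring.
Qed.

Lemma Cpseries_inv (z t : C) :
  z <> 0 -> Cmod t < Cmod z -> Cpseries (fun n => (- (1)) ^ n / z ^ S n)%C t (/ (z + t))%C.
Proof.
  intros Hz Ht. apply Cpseries_Cseries, Cseries_spec.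
  pose proof (Cplus_neq_0 z t Ht) as Hzt.
  assert (Hm : 0 < Cmod z) by now apply Cmod_gt_0.
  assert (Hmt : 0 < Cmod (z + t)) by now apply Cmod_gt_0.
  (* Exact remainder of the geometric series with ratio [- t / z]. *)
  assert (E : forall n, (Csum (fun k => t ^ k * ((- (1)) ^ k / z ^ S k)) n - / (z + t)
     = - (((- (1)) * t / z) ^ S n / (z + t)))%C).
  { induction n as [|n IH].
    - rewrite sum_O. simpl. field. now split.
    - rewrite sum_Sn. change (@plus (NormedModule.AbelianMonoid _ C_NormedModule)) with Cplus.
      match goal with |- (?s + ?u - ?v)%C = _ =>
        replace (s + u - v)%C with ((s - v) + u)%C by ring end.
      rewrite IH. unfold Cdiv. rewrite !Cpow_mult_l, !Cpow_S, !Cpow_inv by exact Hz.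
      field. repeat split; try assumption. now apply Cpow_nz. }
  intros eps He.
  assert (Hq : Rabs (Cmod t / Cmod z) < 1).
  { rewrite Rabs_pos_eq.
    - apply Rlt_div_l; lra.
    - apply Rdiv_le_0_compat; [apply Cmod_ge_0|lra]. }
  destruct (pow_lt_1_zero _ Hq (eps * Cmod (z + t))) as [N HN].
  { now apply Rmult_lt_0_compat. }
  exists N. intros n Hn. rewrite E, Cmod_opp, Cmod_div by exact Hzt.
  apply Rlt_div_l; [lra|].
  rewrite Cmod_pow, Cmod_div, Cmod_mult, Cmod_m1, Rmult_1_l by exact Hz.
  eapply Rle_lt_trans; [apply Rle_abs|]. apply HN. lia.
Qed.

Lemma holomorphic_at_0_inv (z : C) : z <> 0 -> holomorphic_at_0 (fun t => / (z + t))%C.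
Proof.
  intros Hz. exists (fun n => (- (1)) ^ n / z ^ S n)%C, (Cmod z).
  split; [now apply Cmod_gt_0|]. intros t Ht. now apply Cpseries_inv.
Qed.

(** Order 1 is used even where the function is regular, so that the two fractions of [dfrakS] can be
    subtracted coefficientwise; [c O] is then the residue. *)
Lemma laurent_expansion_inv (z : C) :
  exists c, laurent_expansion (fun t => / (z + t))%C 1 c /\
    c O = if Ceq_dec z 0 then RtoC 1 else RtoC 0.
Proof.
  destruct (Ceq_dec z 0) as [->|Hz].
  - exists (fun n => match n with O => RtoC 1 | S _ => RtoC 0 end).
    split; [|reflexivity]. exists 1. split; [lra|].
    intros t [Ht _]. apply Cmod_gt_0 in Ht.
    replace (t ^ 1 * / (0 + t))%C with (RtoC 1) by (simpl; field; exact Ht).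
    apply Cpseries_Cseries, Cseries_spec. intros eps He. exists O. intros n _.
    replace (Csum _ n) with (RtoC 1).
    + replace (1 - 1)%C with (RtoC 0) by ring. now rewrite Cmod_0.
    + symmetry. induction n as [|n IH].
      * rewrite sum_O. simpl. ring.
      * rewrite sum_Sn, IH. change (1 + t ^ S n * 0 = 1)%C. ring.
  - destruct (holomorphic_laurent_expansion _ (holomorphic_at_0_inv z Hz)) as [c Hc].
    exists (@PS_incr_n C_AbsRing C_NormedModule c 1). split; [|reflexivity].
    now apply (laurent_expansion_shift _ 0 1).
Qed.

Definition dfrakS (a : C) : C := (/ (a + 1) - / (a - 1))%C.

Lemma holomorphic_at_0_dfrakS (p : C) :
  p <> RtoC 1 -> p <> RtoC (-1) -> holomorphic_at_0 (fun t => dfrakS (p + t)).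
Proof.
  intros H1 H2.
  apply (holomorphic_at_0_ext (fun t => / ((p + 1) + t) - / ((p - 1) + t))%C _ 1 Rlt_0_1).
  { intros t _. unfold dfrakS. f_equal; f_equal; ring. }
  apply holomorphic_at_0_minus; apply holomorphic_at_0_inv; intros E.
  - apply H2. replace p with (p + 1 + - (1))%C by ring. rewrite E.
    apply injective_projections; simpl; ring.
  - apply H1. replace p with (p - 1 + 1)%C by ring. rewrite E. ring.
Qed.

Lemma laurent_expansion_dfrakS (p : C) :
  exists c, laurent_expansion (fun t => dfrakS (p + t)) 1 c /\
    (p = RtoC 1 -> c O = RtoC (-1)) /\ (p = RtoC (-1) -> c O = RtoC 1).
Proof.
  destruct (laurent_expansion_inv (p + 1)) as [c [Hc Hc0]].
  destruct (laurent_expansion_inv (p - 1)) as [d [Hd Hd0]].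
  exists (fun n => c n - d n)%C. repeat split.
  - refine (laurent_expansion_ext _ _ _ _ 1 Rlt_0_1 _ (laurent_expansion_minus _ _ _ _ _ Hc Hd)).
    intros t _. unfold dfrakS. f_equal; f_equal; ring.
  - intros ->. rewrite Hc0, Hd0.
    destruct (Ceq_dec _ _) as [E|_]; [apply (f_equal fst) in E; simpl in E; lra|].
    destruct (Ceq_dec _ _) as [_|E]; [|exfalso; apply E; ring].
    apply injective_projections; simpl; ring.
  - intros ->. rewrite Hc0, Hd0.
    destruct (Ceq_dec _ _) as [_|E];
      [|exfalso; apply E; apply injective_projections; simpl; ring].
    destruct (Ceq_dec _ _) as [E|_]; [apply (f_equal fst) in E; simpl in E; lra|].
    apply injective_projections; simpl; ring.
Qed.

(** The form [dfrakS a da] is invariant under [a |-> 1 / a]. *)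
Lemma dfrakS_inv (w : C) :
  w <> 0 -> Cmod w < 1 -> (- (dfrakS (/ w) / w ^ 2))%C = dfrakS w.
Proof.
  intros Hw Hw1. unfold dfrakS.
  assert (H1 : (1 + w <> 0)%C) by (apply Cplus_neq_0; rewrite Cmod_1; exact Hw1).
  assert (H2 : (- (1) + w <> 0)%C) by (apply Cplus_neq_0; rewrite Cmod_m1; exact Hw1).
  assert (H3 : (1 - w <> 0)%C).
  { intros E. apply H2. replace (- (1) + w)%C with (- (1 - w))%C by ring. rewrite E. ring. }
  field. repeat split; try assumption.
  - now replace (w - 1)%C with (- (1) + w)%C by ring.
  - now replace (w + 1)%C with (1 + w)%C by ring.
Qed.

(** * The identity theorem for meromorphic functions on the plane *)

(** Let [m] be the supremum of the initial segments on which [P] holds, bounded if [P] fails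
    somewhere. The limit clause gives [P m], and the step clause then extends the segment past [m],
    a contradiction. *)
Lemma real_induction (P : R -> Prop) :
  P 0 ->
  (forall s, 0 <= s -> P s -> exists e, 0 < e /\ forall u, s <= u < s + e -> P u) ->
  (forall s, 0 < s -> (forall u, 0 <= u < s -> P u) -> P s) ->
  forall s, 0 <= s -> P s.
Proof.
  intros H0 Hstep Hlim s Hs. apply NNPP; intros HP.
  set (E := fun x => 0 <= x /\ forall u, 0 <= u <= x -> P u).
  assert (HE0 : E 0).
  { split; [lra|]. intros u Hu. now replace u with 0 by lra. }
  destruct (completeness E) as [m [Hub Hlub]].
  { exists s. intros x [Hx HxP]. destruct (Rle_lt_dec x s) as [|Hlt]; [assumption|].
    exfalso; apply HP, HxP. lra. }
  { now exists 0. }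
  assert (Hm : 0 <= m) by now apply Hub.
  assert (Hbelow : forall u, 0 <= u < m -> P u).
  { intros u Hu. apply NNPP; intros Hn.
    assert (m <= u); [|lra]. apply Hlub. intros x [Hx HxP].
    destruct (Rle_lt_dec x u) as [|Hlt]; [assumption|].
    exfalso; apply Hn, HxP. lra. }
  assert (HPm : P m).
  { destruct (Req_dec m 0) as [->|Hne]; [exact H0|]. apply Hlim; [lra|exact Hbelow]. }
  destruct (Hstep m Hm HPm) as [e [He HPe]].
  assert (m + e / 2 <= m); [|lra].
  apply Hub. split; [lra|]. intros u Hu.
  destruct (Rlt_le_dec u m); [apply Hbelow|apply HPe]; lra.
Qed.

Lemma identity_theorem (f g : C -> C) :
  (forall p, exists N c, laurent_expansion (fun t => f (p + t)%C) N c) ->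
  (forall p, exists N c, laurent_expansion (fun t => g (p + t)%C) N c) ->
  (forall a, 0 < Im a -> f a = g a) ->
  forall p, exists r, 0 < r /\ forall t, 0 < Cmod t < r -> f (p + t)%C = g (p + t)%C.
Proof.
  intros Hf Hg Hfg.
  set (A := fun p => exists r, 0 < r /\ forall t, 0 < Cmod t < r -> f (p + t)%C = g (p + t)%C).
  (* Points of agreement accumulating at [p] suffice for agreement around [p]; both expansions are
     padded to order [M + N] before being compared. *)
  assert (Hacc : forall p, (forall eps, 0 < eps ->
     exists t, 0 < Cmod t < eps /\ f (p + t)%C = g (p + t)%C) -> A p).
  { intros p Hp. destruct (Hf p) as [N [c Hc]]. destruct (Hg p) as [M [d Hd]].
    apply (laurent_expansion_shift _ _ M) in Hc.
    apply (laurent_expansion_shift _ _ N) in Hd.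
    rewrite (Nat.add_comm N M) in Hd.
    exact (proj2 (laurent_identity _ _ _ _ _ Hc Hd Hp)). }
  assert (Hi : forall x : R, Cmod (Ci * RtoC x)%C = Rabs x)
    by (intros x; rewrite Cmod_mult, Cmod_Ci, Cmod_R; ring).
  intros p.
  set (K := 1 + Rabs (Im p)).
  assert (HK : 0 < K /\ 0 < Im p + K).
  { pose proof (Rabs_pos (Im p)). pose proof (Rabs_maj2 (Im p)). unfold K. lra. }
  change (A p).
  replace p with (p + Ci * RtoC (K - K))%C
    by (apply injective_projections; simpl; ring).
  (* descend vertically from [p + i K], which lies in the upper half-plane *)
  apply (real_induction (fun s => A (p + Ci * RtoC (K - s))%C)); [| | |lra].
  - apply Hacc. intros eps He. exists (RtoC (eps / 2)). split.
    + rewrite Cmod_R, Rabs_pos_eq; lra.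
    + apply Hfg. unfold Im in *; simpl. lra.
  - intros s Hs [r [Hr HA]]. exists r. split; [exact Hr|].
    intros u Hu. apply Hacc. intros eps He.
    destruct (Req_dec u s) as [->|Hne].
    + exists (RtoC (Rmin r eps / 2)).
      pose proof (Rmin_l r eps); pose proof (Rmin_r r eps).
      assert (0 < Rmin r eps) by now apply Rmin_glb_lt.
      assert (Cmod (RtoC (Rmin r eps / 2)) = Rmin r eps / 2) by (rewrite Cmod_R, Rabs_pos_eq; lra).
      split; [lra|]. apply HA. lra.
    (* Going down a further [k] from the point at [u] stays in the punctured disc around the point
       at [s], because [0 < u - s + k < r]. *)
    + set (k := Rmin (s + r - u) eps / 2).
      assert (Hk : 0 < k /\ k < s + r - u /\ k < eps).
      { pose proof (Rmin_l (s + r - u) eps); pose proof (Rmin_r (s + r - u) eps).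
        assert (0 < Rmin (s + r - u) eps) by (apply Rmin_glb_lt; lra). unfold k. lra. }
      exists (Ci * RtoC (- k))%C. split.
      * rewrite Hi, Rabs_Ropp, Rabs_pos_eq; lra.
      * replace (p + Ci * RtoC (K - u) + Ci * RtoC (- k))%C
          with (p + Ci * RtoC (K - s) + Ci * RtoC (- (u - s + k)))%C
          by (apply injective_projections; simpl; ring).
        apply HA. rewrite Hi, Rabs_Ropp, Rabs_pos_eq; lra.
  - intros s Hs HA. apply Hacc. intros eps He.
    (* Step back up to the parameter [s - k]. Its centre is excluded from the disc of agreement, so
       move up a further [h]; the total displacement [k + h] stays below [eps]. *)
    set (k := Rmin s eps / 2).
    assert (Hk : 0 < k /\ k < s /\ k < eps).
    { pose proof (Rmin_l s eps); pose proof (Rmin_r s eps).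
      assert (0 < Rmin s eps) by (apply Rmin_glb_lt; lra). unfold k. lra. }
    destruct (HA (s - k)) as [r [Hr Hu]]; [lra|].
    set (h := Rmin r (eps - k) / 2).
    assert (Hh : 0 < h /\ h < r /\ h < eps - k).
    { pose proof (Rmin_l r (eps - k)); pose proof (Rmin_r r (eps - k)).
      assert (0 < Rmin r (eps - k)) by (apply Rmin_glb_lt; lra). unfold h. lra. }
    exists (Ci * RtoC (k + h))%C. split.
    + rewrite Hi, Rabs_pos_eq; lra.
    + replace (p + Ci * RtoC (K - s) + Ci * RtoC (k + h))%C
        with (p + Ci * RtoC (K - (s - k)) + Ci * RtoC h)%C
        by (apply injective_projections; simpl; ring).
      apply Hu. rewrite Hi, Rabs_pos_eq; lra.
Qed.

(** * The complex derivative of the logarithm on the upper half-plane *)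

(** With [u = Re z / Cmod z], [acos u] is [PI / 2 - asin u] and [asin u] is the arctangent of
    [u / sqrt (1 - u²)], where the root equals [Im z / Cmod z]. *)
Lemma Carg_upper (z : C) : 0 < Im z -> Carg z = PI / 2 - atan (Re z / Im z).
Proof.
  intros Hy.
  assert (Hm2 := Cmod2_alt z).
  assert (Hm : 0 < Cmod z).
  { apply Cmod_gt_0. intros ->. simpl in Hy. lra. }
  unfold Carg. destruct (Rle_dec 0 (Im z)) as [_|]; [|lra].
  assert (Hb : -1 < Re z / Cmod z < 1).
  { split; [apply Rlt_div_r|apply Rlt_div_l]; try lra; nra. }
  rewrite acos_asin, asin_atan by lra.
  f_equal; f_equal.
  assert (E : sqrt (1 - (Re z / Cmod z)²) = Im z / Cmod z).
  { replace (1 - (Re z / Cmod z)²) with ((Im z / Cmod z)²).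
    - apply sqrt_Rsqr. apply Rdiv_le_0_compat; lra.
    - unfold Rsqr. replace (Im z / Cmod z * (Im z / Cmod z)) with (Im z ^ 2 / Cmod z ^ 2) by (field; lra).
      replace (Im z ^ 2) with (Cmod z ^ 2 - Re z ^ 2) by lra. field. lra. }
  rewrite E. field. lra.
Qed.

(** Sufficiency of the Cauchy-Riemann equations: the real differential with rows [(p, - q)] and
    [(q, p)] is multiplication by [p + i q]. *)
Lemma is_derive_C_of_differentiable (f : C -> C) (u v : R -> R -> R) (x y p q : R) :
  locally_2d (fun s t => f (s, t) = (u s t, v s t)) x y ->
  differentiable_pt_lim u x y p (- q) ->
  differentiable_pt_lim v x y q p ->
  is_derive (K := C_AbsRing) (V := C_NormedModule) f (x, y) (p, q).
Proof.
  intros [d Hf] Hu Hv. split; [apply is_linear_scal_l|].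
  intros z Hz.
  apply (is_filter_lim_locally_unique (K := C_AbsRing) (V := AbsRing_NormedModule C_AbsRing)) in Hz.
  subst z. intros eps.
  (* The complex error is bounded by the sum of the errors of [u] and [v], each granted half of
     [eps]. *)
  assert (He : 0 < eps / 2) by (pose proof (cond_pos eps); lra).
  destruct (Hu (mkposreal _ He)) as [d1 H1]. destruct (Hv (mkposreal _ He)) as [d2 H2].
  assert (Hd : 0 < Rmin d (Rmin d1 d2)).
  { repeat apply Rmin_glb_lt; apply cond_pos. }
  exists (mkposreal _ Hd). intros [s t] Hst.
  change (Cmod ((s, t) - (x, y)) < Rmin d (Rmin d1 d2)) in Hst.
  change (Cmod (f (s, t) - f (x, y) - ((s, t) - (x, y)) * (p, q)) <= eps * Cmod ((s, t) - (x, y))).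
  pose proof (Rmin_l d (Rmin d1 d2)); pose proof (Rmin_r d (Rmin d1 d2)).
  pose proof (Rmin_l d1 d2); pose proof (Rmin_r d1 d2).
  pose proof (Rmax_Cmod ((s, t) - (x, y))%C) as Hm. simpl fst in Hm; simpl snd in Hm.
  change (s + - x) with (s - x) in Hm; change (t + - y) with (t - y) in Hm.
  pose proof (Rmax_l (Rabs (s - x)) (Rabs (t - y))); pose proof (Rmax_r (Rabs (s - x)) (Rabs (t - y))).
  specialize (H1 s t ltac:(lra) ltac:(lra)). specialize (H2 s t ltac:(lra) ltac:(lra)). simpl in H1, H2.
  pose proof (cond_pos d) as Hd0.
  rewrite (Hf s t) by lra. rewrite (Hf x y) by (rewrite Rminus_diag, Rabs_R0; lra).
  set (a := u s t - u x y - (p * (s - x) + - q * (t - y))) in *.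
  set (b := v s t - v x y - (q * (s - x) + p * (t - y))) in *.
  replace ((u s t, v s t) - (u x y, v x y) - ((s, t) - (x, y)) * (p, q))%C
    with (RtoC a + Ci * RtoC b)%C
    by (apply injective_projections; unfold a, b; simpl; ring).
  eapply Rle_trans; [apply Cmod_triangle|].
  rewrite Cmod_mult, Cmod_Ci, !Cmod_R.
  apply Rle_trans with (eps * Rmax (Rabs (s - x)) (Rabs (t - y))); [lra|].
  apply Rmult_le_compat_l; [lra|exact Hm].
Qed.

Lemma locally_2d_upper (P : R -> R -> Prop) (x y : R) :
  0 < y -> (forall s t, 0 < t -> P s t) -> locally_2d P x y.
Proof.
  intros Hy H. exists (mkposreal y Hy). intros s t _ Ht. apply H.
  apply Rabs_lt_between in Ht. simpl in Ht. lra.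
Qed.

(** Here [p] and [q] are the components of [/ z], namely [x / (x ^ 2 + y ^ 2)] and
    [- y / (x ^ 2 + y ^ 2)]. Real differentiability follows from a continuous partial derivative in
    the first variable and an existing one in the second. *)
Lemma is_derive_Clog (z : C) :
  0 < Im z -> is_derive (K := C_AbsRing) (V := C_NormedModule) Clog z (/ z)%C.
Proof.
  destruct z as [x y]. unfold Im; simpl. intros Hy.
  assert (Hpos : forall s t : R, 0 < t -> 0 < s ^ 2 + t ^ 2) by (intros; nra).
  (* Both first partial derivatives have this shape, with numerator [s] for the modulus part and
     [- t] for the argument. *)
  assert (Hc : forall (k : R -> R -> R), continuous (fun w : R * R => k (fst w) (snd w)) (x, y) ->
     continuous (fun w : R * R => k (fst w) (snd w) * / (fst w ^ 2 + snd w ^ 2)) (x, y)).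
  { intros k Hk. apply (continuous_mult (K := R_AbsRing) (fun w : R * R => k (fst w) (snd w))
      (fun w : R * R => / (fst w ^ 2 + snd w ^ 2))); [exact Hk|].
    apply (continuous_comp (fun w : R * R => fst w ^ 2 + snd w ^ 2) Rinv).
    - apply (continuous_plus (V := R_NormedModule) (fun w : R * R => fst w ^ 2) (fun w : R * R => snd w ^ 2)).
      + apply (continuous_comp fst (fun t => t ^ 2)); [apply continuous_fst|].
        apply (ex_derive_continuous (V := R_NormedModule) (fun t : R => t ^ 2)). auto_derive. exact I.
      + apply (continuous_comp snd (fun t => t ^ 2)); [apply continuous_snd|].
        apply (ex_derive_continuous (V := R_NormedModule) (fun t : R => t ^ 2)). auto_derive. exact I.
    - apply continuous_Rinv. simpl fst; simpl snd. specialize (Hpos x y Hy). lra. }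
  apply (is_derive_C_of_differentiable _ (fun s t => ln (sqrt (s ^ 2 + t ^ 2)))
           (fun s t => PI / 2 - atan (s / t))).
  - apply locally_2d_upper; [exact Hy|]. intros s t Ht.
    unfold Clog. now rewrite Carg_upper.
  - apply filterdiff_differentiable_pt_lim.
    apply (filterdiff_ext_lin _ (fun w : R * R => plus (scal (fst w) (x * / (x ^ 2 + y ^ 2)))
       (scal (snd w) (- (- y / (x ^ 2 + y ^ 2)))))).
    2: { intros w. reflexivity. }
    apply (is_derive_filterdiff (fun s t => ln (sqrt (s ^ 2 + t ^ 2))) x y
             (fun s t => s * / (s ^ 2 + t ^ 2))).
    + apply (locally_2d_locally (fun s t => is_derive (fun r : R => ln (sqrt (r ^ 2 + t ^ 2))) s (s * / (s ^ 2 + t ^ 2)))).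
      apply locally_2d_upper; [exact Hy|]. intros s t Ht. specialize (Hpos s t Ht).
      pose proof (sqrt_lt_R0 _ Hpos) as Hs. pose proof (sqrt_sqrt (s ^ 2 + t ^ 2) ltac:(lra)) as Hss.
      auto_derive.
      * replace (s * (s * 1) + t * (t * 1)) with (s ^ 2 + t ^ 2) by ring. now split.
      * replace (s * (s * 1) + t * (t * 1)) with (s ^ 2 + t ^ 2) by ring.
        rewrite <- Hss at 3. field. lra.
    + specialize (Hpos x y Hy).
      pose proof (sqrt_lt_R0 _ Hpos) as Hs. pose proof (sqrt_sqrt (x ^ 2 + y ^ 2) ltac:(lra)) as Hss.
      auto_derive.
      * replace (x * (x * 1) + y * (y * 1)) with (x ^ 2 + y ^ 2) by ring. now split.
      * replace (x * (x * 1) + y * (y * 1)) with (x ^ 2 + y ^ 2) by ring.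
        rewrite <- Hss at 3. field. lra.
    + apply (Hc (fun s _ => s)). apply continuous_fst.
  - apply filterdiff_differentiable_pt_lim.
    apply (filterdiff_ext_lin _ (fun w : R * R => plus (scal (fst w) (- y * / (x ^ 2 + y ^ 2)))
       (scal (snd w) (x / (x ^ 2 + y ^ 2))))).
    2: { intros w. reflexivity. }
    apply (is_derive_filterdiff (fun s t => PI / 2 - atan (s / t)) x y
             (fun s t => - t * / (s ^ 2 + t ^ 2))).
    + apply (locally_2d_locally (fun s t => is_derive (fun r : R => PI / 2 - atan (r / t)) s (- t * / (s ^ 2 + t ^ 2)))).
      apply locally_2d_upper; [exact Hy|]. intros s t Ht. specialize (Hpos s t Ht).
      auto_derive; [exact I|]. unfold Rsqr. field. split; [lra|]. nra.
    + specialize (Hpos x y Hy).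
      auto_derive; [lra|]. unfold Rsqr. field. split; [lra|]. nra.
    + apply (Hc (fun _ t => - t)). apply (continuous_opp (V := R_NormedModule) (fun w : R * R => snd w)), continuous_snd.
Qed.

Lemma is_derive_frakS (a : C) :
  0 < Im a -> is_derive (K := C_AbsRing) (V := C_NormedModule) frakS a (dfrakS a).
Proof.
  intros Ha.
  assert (Hs : forall b : R, is_derive (K := C_AbsRing) (V := C_NormedModule)
            (fun z => Clog (z + RtoC b)%C) a (/ (a + RtoC b))%C).
  { intros b.
    replace (/ (a + RtoC b))%C with (@scal C_AbsRing C_NormedModule (1 + 0)%C (/ (a + RtoC b))%C)
      by (change ((1 + 0) * / (a + RtoC b) = / (a + RtoC b))%C; ring).
    apply (is_derive_comp (K := C_AbsRing) (V := C_NormedModule) Clog (fun z => (z + RtoC b)%C)).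
    - apply is_derive_Clog. unfold Im in *. simpl. lra.
    - apply (is_derive_plus (K := C_AbsRing) (V := AbsRing_NormedModule C_AbsRing)
         (fun z => z) (fun _ => RtoC b)).
      + apply (is_derive_id (K := C_AbsRing)).
      + exact (is_derive_const (K := C_AbsRing) (V := AbsRing_NormedModule C_AbsRing) (RtoC b) a). }
  apply (is_derive_ext (K := C_AbsRing) (V := C_NormedModule)
     (fun z => Clog (z + RtoC 1) - Clog (z + RtoC (-1)))%C).
  - intros z. unfold frakS. f_equal. f_equal. apply injective_projections; simpl; ring.
  - unfold dfrakS. replace (a - 1)%C with (a + RtoC (-1))%C
      by (apply injective_projections; simpl; ring).
    apply (is_derive_minus (K := C_AbsRing) (V := C_NormedModule)
      (fun z => Clog (z + RtoC 1)%C) (fun z => Clog (z + RtoC (-1))%C)); apply Hs.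
Qed.

(** * Boundary values on the real axis *)

Lemma ex_derive_filterlim_at_right (f : R -> R) (x l : R) :
  ex_derive (V := R_NormedModule) f x -> f x = l -> filterlim f (at_right x) (locally l).
Proof.
  intros Hf <-.
  apply (filterlim_filter_le_1 (F := locally x)); [apply filter_le_within|].
  exact (ex_derive_continuous (V := R_NormedModule) f x Hf).
Qed.

(** For [x > 0] the identity [atan (x / e) = PI / 2 - atan (e / x)] replaces the singular quotient
    by one continuous at [e = 0]; oddness covers [x < 0]. *)
Lemma filterlim_atan_at_right (x : R) :
  x <> 0 -> filterlim (fun e => atan (x / e)) (at_right 0) (locally (sign x * (PI / 2))).
Proof.
  intros Hx.
  assert (Hpos : forall x, 0 < x -> filterlim (fun e => atan (x / e)) (at_right 0) (locally (PI / 2))).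
  { clear x Hx. intros x Hx.
    apply (filterlim_ext_loc (fun e => PI / 2 - atan (e / x))).
    - exists (mkposreal 1 Rlt_0_1). intros e _ He.
      replace (x / e) with (/ (e / x)) by (field; lra).
      rewrite atan_inv; [reflexivity|]. now apply Rdiv_lt_0_compat.
    - apply ex_derive_filterlim_at_right; [auto_derive; exact I|].
      unfold Rdiv. rewrite Rmult_0_l, atan_0. ring. }
  destruct (Rdichotomy _ _ Hx) as [H|H].
  - rewrite sign_eq_m1 by exact H.
    apply (filterlim_ext (fun e => - atan (- x / e))).
    + intros e. rewrite <- atan_opp. f_equal. unfold Rdiv. ring.
    + replace (-1 * (PI / 2)) with (- (PI / 2)) by ring.
      eapply filterlim_comp; [apply Hpos; lra|]. apply (filterlim_opp (V := R_NormedModule)).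
  - rewrite sign_eq_1 by exact H. rewrite Rmult_1_l. now apply Hpos.
Qed.

Lemma RtoC_plus_Ci_mult (x y : R) : (RtoC x + Ci * RtoC y)%C = (x, y).
Proof. apply injective_projections; simpl; ring. Qed.

(** The limit of the argument is 0 for [x > 0] and [PI] for [x < 0]; the expression with [sign]
    covers both. *)
Lemma filterlim_Clog_at_right (x : R) :
  x <> 0 ->
  filterlim (fun e : R => Clog (RtoC x + Ci * RtoC e)%C) (at_right 0)
    (locally ((ln (Rabs x), PI / 2 - sign x * (PI / 2)) : C)).
Proof.
  intros Hx.
  apply (filterlim_ext_loc (fun e => (ln (sqrt (x ^ 2 + e ^ 2)), PI / 2 - atan (x / e)) : C)).
  { exists (mkposreal 1 Rlt_0_1). intros e _ He.
    rewrite RtoC_plus_Ci_mult.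
    unfold Clog. rewrite Carg_upper by exact He. reflexivity. }
  apply (filterlim_filter_le_2 (G := filter_prod (locally (ln (Rabs x)))
     (locally (PI / 2 - sign x * (PI / 2))))).
  { intros P [e He]. exists (ball (ln (Rabs x)) e) (ball (PI / 2 - sign x * (PI / 2)) e);
      [apply locally_ball|apply locally_ball|]. intros s t Hs Ht. apply He. now split. }
  apply filterlim_pair.
  - apply ex_derive_filterlim_at_right.
    + auto_derive. assert (0 < x * (x * 1) + 0 * (0 * 1)) by nra.
      split; [assumption|]. split; [now apply sqrt_lt_R0|exact I].
    + rewrite <- sqrt_Rsqr_abs. f_equal. f_equal. unfold Rsqr. ring.
  - eapply filterlim_comp; [now apply filterlim_atan_at_right|].
    apply (ex_derive_continuous (V := R_NormedModule) (fun t : R => PI / 2 - t)). auto_derive. exact I.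
Qed.

(** Between -1 and 1 the limit has imaginary part [- PI], coming from [Clog (a - 1)]; the real part
    is free of this jump. *)
Lemma filterlim_frakS_at_right (a : R) :
  a <> 1 -> a <> -1 ->
  exists L : C,
    filterlim (fun eps : R => frakS (RtoC a + Ci * RtoC eps)%C) (at_right 0) (locally L) /\
    Re L = ln (Rabs (a + 1)) - ln (Rabs (a - 1)).
Proof.
  intros H1 H2.
  eexists. split.
  - apply (filterlim_comp_2 (F := at_right 0)
      (G := locally ((ln (Rabs (a + 1)), PI / 2 - sign (a + 1) * (PI / 2)) : C))
      (H := locally ((ln (Rabs (a - 1)), PI / 2 - sign (a - 1) * (PI / 2)) : C))
      (fun e : R => Clog (RtoC a + Ci * RtoC e + 1)%C)
      (fun e : R => Clog (RtoC a + Ci * RtoC e - 1)%C) Cminus).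
    + eapply filterlim_ext; [|apply (filterlim_Clog_at_right (a + 1)); lra].
      intros e. rewrite RtoC_plus. f_equal. ring.
    + eapply filterlim_ext; [|apply (filterlim_Clog_at_right (a - 1)); lra].
      intros e. rewrite RtoC_minus. f_equal. ring.
    + eapply (filterlim_comp_2 (T := C * C) fst (fun w : C * C => Copp (snd w)) Cplus).
      * apply filterlim_fst.
      * eapply filterlim_comp; [apply filterlim_snd|]. apply (filterlim_opp (V := C_R_NormedModule)).
      * apply (filterlim_plus (V := C_R_NormedModule)).
  - reflexivity.
Qed.

(** * Existence of the continued form, and its determination by [dfrakS] *)

(** Near infinity the coefficient is again [dfrakS w], by invariance under inversion, so [dfrakS 0]
    is the value at [w = 0] that makes the form holomorphic there. *)
Definition dfrakS_form : one_form.
Proof.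
  refine {| coef := dfrakS;
            coef_infty := fun w => if Ceq_dec w 0 then dfrakS 0
                                   else (- (dfrakS (/ w) / w ^ 2))%C |}.
  intros w Hw. destruct (Ceq_dec w 0); [contradiction|reflexivity].
Defined.

Lemma continues_differential_dfrakS_form : continues_differential frakS dfrakS_form.
Proof.
  split; [|exact is_derive_frakS].
  intros [p|].
  - destruct (laurent_expansion_dfrakS p) as [c [Hc [E1 E2]]].
    destruct (Ceq_dec p (RtoC 1)) as [H1|H1].
    { right. exists 1%nat. split; [apply le_n|]. exists c. split; [exact Hc|].
      rewrite (E1 H1). intros E. apply (f_equal fst) in E. simpl in E. lra. }
    destruct (Ceq_dec p (RtoC (-1))) as [H2|H2].
    { right. exists 1%nat. split; [apply le_n|]. exists c. split; [exact Hc|].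
      rewrite (E2 H2). intros E. apply (f_equal fst) in E. simpl in E. lra. }
    left. now apply holomorphic_at_0_dfrakS.
  - left. apply (holomorphic_at_0_ext (fun w => dfrakS (0 + w)%C) _ 1 Rlt_0_1).
    + intros w Hw. rewrite Cplus_0_l. simpl.
      destruct (Ceq_dec w 0) as [->|Hne]; [reflexivity|].
      symmetry. now apply dfrakS_inv.
    + apply holomorphic_at_0_dfrakS; intros E; apply (f_equal fst) in E; simpl in E; lra.
Qed.

Lemma continues_differential_coef (omega : one_form) (p : C) :
  continues_differential frakS omega ->
  exists r, 0 < r /\ forall t, 0 < Cmod t < r -> coef omega (p + t)%C = dfrakS (p + t)%C.
Proof.
  intros [Hmer Hder].
  apply (identity_theorem (coef omega) dfrakS).
  - intros q. exact (meromorphic_laurent_expansion omega (Fin q) Hmer).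
  - intros q. destruct (laurent_expansion_dfrakS q) as [c [Hc _]]. now exists 1%nat, c.
  - intros a Ha.
    rewrite <- (is_C_derive_unique _ _ _ (Hder a Ha)).
    apply is_C_derive_unique. now apply is_derive_frakS.
Qed.

(** A pole at [p] is impossible, since [dfrakS] has an expansion of order 0 there; holomorphy then
    settles the value at [p] itself. Exact values are wanted because [coef_compat] relates the
    charts pointwise. *)
Lemma continues_differential_coef_eq (omega : one_form) (p : C) :
  continues_differential frakS omega -> p <> RtoC 1 -> p <> RtoC (-1) ->
  coef omega p = dfrakS p.
Proof.
  intros Ho H1 H2.
  pose proof (holomorphic_at_0_dfrakS p H1 H2) as Hd.
  destruct (continues_differential_coef omega p Ho) as [r [Hr Hco]].
  destruct (proj1 Ho (Fin p)) as [Hh|[N [HN [c [Hc H0]]]]].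
  - rewrite <- (Cplus_0_r p).
    exact (holomorphic_at_0_eq (fun t => coef omega (p + t)%C) _ r Hh Hd Hr Hco).
  - exfalso.
    destruct (holomorphic_laurent_expansion _ Hd) as [d Hd'].
    apply (laurent_expansion_ext _ (fun t => dfrakS (p + t)%C) _ _ r Hr Hco) in Hc.
    pose proof (laurent_order_le _ _ _ _ _ Hc H0 Hd'). lia.
Qed.

Lemma continues_differential_coef_infty (omega : one_form) (w : C) :
  continues_differential frakS omega -> 0 < Cmod w < 1 ->
  coef_infty omega w = dfrakS (0 + w)%C.
Proof.
  intros Ho Hw. assert (Hnz : w <> 0) by (apply Cmod_gt_0; lra).
  rewrite Cplus_0_l, coef_compat by exact Hnz.
  (* For [0 < Cmod w < 1] the point [/ w] lies outside the closed unit disc, away from both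
     poles. *)
  assert (Hi : forall z : C, Cmod z = 1 -> (/ w)%C <> z).
  { intros z Hz E. rewrite <- E, Cmod_inv in Hz by exact Hnz.
    assert (1 < / Cmod w); [|lra]. rewrite <- Rinv_1 at 1. apply Rinv_lt_contravar; lra. }
  rewrite continues_differential_coef_eq; [apply dfrakS_inv; [exact Hnz|lra]|exact Ho| |];
    apply Hi; rewrite Cmod_R, ?Rabs_R1, ?Rabs_m1; reflexivity.
Qed.

(** Treats finite points and infinity alike: infinity is modelled by [z = 0]. The last clause
    recovers [p] from [z] at the two poles of [dfrakS], which are real and nonzero. *)
Lemma local_coef_dfrakS (omega : one_form) (p : sphere) :
  continues_differential frakS omega ->
  exists (z : C) (r : R), 0 < r /\
    (forall t, 0 < Cmod t < r -> local_coef omega p t = dfrakS (z + t)%C) /\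
    (forall x : R, z = RtoC x -> x <> 0 -> p = Fin (RtoC x)).
Proof.
  intros Ho. destruct p as [z|].
  - exists z. destruct (continues_differential_coef omega z Ho) as [r [Hr H]].
    exists r. split; [exact Hr|]. split; [exact H|]. now intros x ->.
  - exists 0, 1. split; [lra|]. split.
    + intros t Ht. now apply continues_differential_coef_infty.
    + intros x E Hx. apply (f_equal fst) in E. simpl in E. lra.
Qed.

(** Orders are compared with the expansion of [dfrakS]: order 1 exists at every [z], giving
    [N <= 1], and order 0 exists away from 1 and -1, contradicting [1 <= N]. *)
Lemma pole_of_order_continuation (omega : one_form) (p : sphere) (N : nat) :
  continues_differential frakS omega -> pole_of_order omega p N ->
  N = 1%nat /\ (p = Fin (RtoC 1) \/ p = Fin (RtoC (-1))).
Proof.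
  intros Ho [HN [c [Hc H0]]].
  destruct (local_coef_dfrakS omega p Ho) as [z [r [Hr [Hco Hz]]]].
  apply (laurent_expansion_ext _ (fun t => dfrakS (z + t)%C) _ _ r Hr Hco) in Hc.
  split.
  - destruct (laurent_expansion_dfrakS z) as [d [Hd _]].
    pose proof (laurent_order_le _ _ _ _ _ Hc H0 Hd). lia.
  - destruct (Ceq_dec z (RtoC 1)) as [E|H1]; [left; apply Hz; [exact E|lra]|].
    destruct (Ceq_dec z (RtoC (-1))) as [E|H2]; [right; apply Hz; [exact E|lra]|].
    exfalso.
    destruct (holomorphic_laurent_expansion _ (holomorphic_at_0_dfrakS z H1 H2)) as [d Hd].
    pose proof (laurent_order_le _ _ _ _ _ Hc H0 Hd). lia.
Qed.

Lemma laurent_expansion_continuation (omega : one_form) (z : C) :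
  continues_differential frakS omega ->
  exists c, laurent_expansion (local_coef omega (Fin z)) 1 c /\
    (z = RtoC 1 -> c O = RtoC (-1)) /\ (z = RtoC (-1) -> c O = RtoC 1).
Proof.
  intros Ho. destruct (laurent_expansion_dfrakS z) as [c [Hc HE]].
  exists c. split; [|exact HE].
  destruct (continues_differential_coef omega z Ho) as [r [Hr Hco]].
  refine (laurent_expansion_ext _ _ _ _ r Hr _ Hc).
  intros t Ht. symmetry. now apply Hco.
Qed.

(** * The c-entropy, and assembly of the theorem *)

Lemma c_entropy_eq (a : R) :
  0 < a < 1 \/ 1 < a -> c_entropy a = ln (Rabs (a + 1)) - ln (Rabs (a - 1)).
Proof.
  intros Ha. unfold c_entropy. rewrite (Rabs_pos_eq (a + 1)) by lra.
  destruct (Rlt_dec a 1).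
  - rewrite (Rabs_left (a - 1)) by lra. f_equal; f_equal; ring.
  - rewrite (Rabs_pos_eq (a - 1)) by lra. reflexivity.
Qed.

Theorem mainTheorem9 :
  (forall a : R, 0 < a < 1 \/ 1 < a ->
     c_entropy a = ln (Rabs ((a + 1) / (a - 1))) /\
     exists L : C,
       filterlim (fun eps : R => frakS (RtoC a + Ci * RtoC eps)%C)
                 (at_right 0) (locally L) /\
       c_entropy a = Re L) /\
  (exists omega : one_form, continues_differential frakS omega) /\
  (forall omega : one_form, continues_differential frakS omega ->
     third_kind omega /\
     (forall p : sphere,
        simple_pole omega p <-> p = Fin (RtoC 1) \/ p = Fin (RtoC (-1))) /\
     is_residue omega (Fin (RtoC 1)) (RtoC (-1)) /\
     is_residue omega (Fin (RtoC (-1))) (RtoC 1)).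
Proof.
  split; [|split].
  - intros a Ha. split.
    + rewrite c_entropy_eq, Rabs_div, ln_div by (assumption || lra || (apply Rabs_pos_lt; lra)).
      reflexivity.
    + destruct (filterlim_frakS_at_right a) as [L [HL E]]; [lra|lra|].
      exists L. split; [exact HL|]. rewrite E. now apply c_entropy_eq.
  - exists dfrakS_form. exact continues_differential_dfrakS_form.
  - intros omega Ho.
    destruct (laurent_expansion_continuation omega (RtoC 1) Ho) as [c [Hc [Ec _]]].
    destruct (laurent_expansion_continuation omega (RtoC (-1)) Ho) as [d [Hd [_ Ed]]].
    specialize (Ec eq_refl). specialize (Ed eq_refl).
    assert (Hne : forall x : R, x <> 0 -> RtoC x <> 0)
      by (intros x Hx E; apply (f_equal fst) in E; simpl in E; lra).
    split; [split|split; [|split]].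
    + exact (proj1 Ho).
    + intros p N HN. exact (proj1 (pole_of_order_continuation omega p N Ho HN)).
    + intros p. split.
      * intros HN. exact (proj2 (pole_of_order_continuation omega p 1 Ho HN)).
      (* In an expansion of order 1 the leading coefficient is also the residue; being 1 or -1, it
         is nonzero and witnesses the simple pole. *)
      * intros [-> | ->]; (split; [apply le_n|]).
        -- exists c. split; [exact Hc|]. rewrite Ec. apply Hne. lra.
        -- exists d. split; [exact Hd|]. rewrite Ed. apply Hne. lra.
    + now exists 1%nat, c.
    + now exists 1%nat, d.
Qed.
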